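(* Let $f\colon T_1\to T_2$ be a homomorphism of complex tori, let $g_1=\dim T_1$ and $h=\dim(\ker f)_0$, where $(\ker f)_0$ is the connected component of $\ker f$ containing $0$. Then $\deg(f)=\delta_{2g_1}(f)$, and $\delta_{2(g_1-h)}(f)$ is equal to the number of connected components of $\ker f$.
   Context: A complex torus of dimension $g$ is a quotient $T=V/L$ of a complex vector space $V$ of dimension $g$ by a lattice $L$ (a discrete subgroup of $V$ of rank $2g$ generating $V$ as a real vector space). A homomorphism $f\colon T_1=V_1/L_1\to T_2=V_2/L_2$ of complex tori (a holomorphic group homomorphism) is induced by a $\mathbb C$-linear map $\rho_a(f)\colon V_1\to V_2$ with $\rho_a(f)(L_1)\subseteq L_2$ (the analytic representation); its restriction $\rho_r(f)\colon L_1\to L_2$ is the rational representation. $[\rho_r(f)]$ denotes the integral matrix of $\rho_r(f)$, of size $2\dim T_2\times 2\dim T_1$, with respect to chosen $\mathbb Z$-bases of $L_1$ and $L_2$. For $k\ge 1$, the $k$-th determinantal divisor $\delta_k(f)$ is the (positive) greatest common divisor of the minors of order $k$ of $[\rho_r(f)]$ if at least one of them is non-zero, and $\delta_k(f)=0$ otherwise (in particular if $[\rho_r(f)]$ has no minors of order $k$); also $\delta_0(f):=1$. These do not depend on the choice of bases. The connected component $(\ker f)_0$ is a subtorus of $T_1$; $\dim$ denotes complex dimension. The degree $\deg(f)$ is the order of $\ker f$ if $\ker f$ is finite, and $\deg(f):=0$ if $\ker f$ is infinite. *)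

(* Defs.v *)
(* MathComp-Analysis; the field of complex numbers is R[i] for R : realType. *)
From HB Require Import structures.
From mathcomp Require Import all_boot all_order all_algebra.
From mathcomp Require Import finmap generic_quotient ring_quotient complex.
From mathcomp Require Import all_classical all_reals all_analysis.

Set Implicit Arguments.
Unset Strict Implicit.
Unset Printing Implicit Defensive.

Import Order.TTheory GRing.Theory Num.Theory.
Import numFieldNormedType.Exports.

Local Open Scope classical_set_scope.
Local Open Scope ring_scope.
Local Open Scope quotient_scope.

(* Finite-dimensional complex vector spaces come with a norm, which only serves
   to provide the topology and the notion of differentiability: all norms on
   such a space are equivalent. *)
#[short(type="normedVectType")]
HB.structure Definition NormedVector (K : numFieldType) :=
  {V of NormedModule K V & Vector K V}.

HB.instance Definition _ (K : numFieldType) (m n : nat) :=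
  NormedModule.on 'M[K]_(m, n).

Section Lattices.
Context {R : realType} {V : normedVectType R[i]}.
Implicit Types (L : set V) (W : {vspace V}).

(* The bijectivity of the coordinate map forces L to be a subgroup, free of
   rank n with basis e. *)
Definition is_Zbasis L n (e : 'I_n -> V) : Prop :=
  set_bij [set: 'cV[int]_n] L (fun z => \sum_(i < n) e i *~ z i 0).

Definition Zcoord n (e : 'I_n -> V) (l : V) : 'cV[int]_n :=
  xget 0 [set z : 'cV[int]_n | l = \sum_(i < n) e i *~ z i 0].

Definition real_span L : set V :=
  [set v | exists (n : nat) (c : 'I_n -> R) (l : 'I_n -> V),
     (forall i, L (l i)) /\ v = \sum_(i < n) (c i)%:C%C *: l i].

Definition is_lattice W L : Prop :=
  [/\ L `<=` isolated L,
      exists e : 'I_(2 * \dim W) -> V, is_Zbasis L e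
    & real_span L = [set` W]].

End Lattices.

Record complex_torus (R : realType) := ComplexTorus {
  universal_cover : normedVectType R[i];
  lattice : zmodClosed universal_cover;
  latticeP : is_lattice fullv [set` lattice] }.

Definition torus_sort (R : realType) (T : complex_torus R) : Type :=
  quotient_topology (Quotient.quot (lattice T)).
Coercion torus_sort : complex_torus >-> Sortclass.

Section TorusInstances.
Context (R : realType) (T : complex_torus R).
HB.instance Definition _ := Topological.on (torus_sort T).
HB.instance Definition _ := Quotient.on (torus_sort T).
HB.instance Definition _ :=
  GRing.isZmodule.Build (torus_sort T)
    (@Quotient.addqA _ (lattice T)) (@Quotient.addqC _ (lattice T))
    (@Quotient.add0q _ (lattice T)) (@Quotient.addNq _ (lattice T)).
End TorusInstances.

Section Tori.
Context {R : realType}.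
Implicit Types T : complex_torus R.

Definition torus_pi T (v : universal_cover T) : T := \pi_(torus_sort T) v.

Definition torus_dim T : nat := \dim {: universal_cover T}.

(* The complex structure on a torus is the one making the projection from the
   universal cover a local biholomorphism; hence f is holomorphic when, locally
   on the universal cover, it lifts to a complex differentiable map. *)
Definition torus_holomorphic T1 T2 (f : T1 -> T2) : Prop :=
  forall v : universal_cover T1,
  exists F : universal_cover T1 -> universal_cover T2,
    \forall w \near v, differentiable F w /\ f (torus_pi w) = torus_pi (F w).

Record torus_hom T1 T2 := TorusHom {
  torus_hom_fun :> T1 -> T2;
  torus_homD : {morph torus_hom_fun : x y / x + y};
  torus_hom_holomorphic : torus_holomorphic torus_hom_fun }.

(* A subtorus of T of dimension d is the image of a complex subspace W of
   dimension d in which the lattice of T induces a lattice. *)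
Definition subtorus_of_dim T (S : set T) (d : nat) : Prop :=
  exists W : {vspace universal_cover T},
    [/\ is_lattice W ([set` W] `&` [set` lattice T]),
        S = @torus_pi T @` [set` W]
      & \dim W = d].

(* The default value 0 is only used for sets that are not subtori. *)
Definition subtorus_dim T (S : set T) : nat := xget 0%N (subtorus_of_dim S).

End Tori.

Definition increasing_ffun k m (s : {ffun 'I_k -> 'I_m}) : bool :=
  [forall i : 'I_k, forall j : 'I_k, (i < j)%N ==> (s i < s j)%N].

(* As 0 is the neutral element of gcdn, the result is 0 when there is no minor
   of order k or when all of them vanish; the empty minor has value 1. *)
Definition det_divisor m n (M : 'M[int]_(m, n)) (k : nat) : nat :=
  \big[gcdn/0%N]_(s : {ffun 'I_k -> 'I_m} | increasing_ffun s)
  \big[gcdn/0%N]_(t : {ffun 'I_k -> 'I_n} | increasing_ffun t)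
    `|\det (mxsub s t M)|%N.

Section Homomorphisms.
Context {R : realType} {T1 T2 : complex_torus R}.
Implicit Type f : torus_hom T1 T2.

Definition torus_ker f : set T1 := [set x | f x = 0].

Definition torus_ker0 f : set T1 := connected_component (torus_ker f) 0.

Definition torus_ker_components f : set (set T1) :=
  [set connected_component (torus_ker f) x | x in torus_ker f].

Definition torus_deg f : nat :=
  if `[< finite_set (torus_ker f) >] then #|` fset_set (torus_ker f)|%fset
  else 0%N.

(* The linear map inducing f exists because f is holomorphic and is unique
   because the lattice of T2 is discrete; it sends lattice T1 into lattice T2. *)
Definition analytic_rep f : 'Hom(universal_cover T1, universal_cover T2) :=
  xget 0
    [set A : 'Hom(universal_cover T1, universal_cover T2) |
       forall v, f (torus_pi v) = torus_pi (A v)].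

Definition rational_rep_mx f
    (e1 : 'I_(2 * torus_dim T1) -> universal_cover T1)
    (e2 : 'I_(2 * torus_dim T2) -> universal_cover T2) :
    'M[int]_(2 * torus_dim T2, 2 * torus_dim T1) :=
  \matrix_(i, j) Zcoord e2 (analytic_rep f (e1 j)) i 0.

End Homomorphisms.

(* Main.v *)
Require Import Defs.
From mathcomp Require Import all_boot all_order all_algebra.
From mathcomp Require Import fingroup perm finmap.
From mathcomp Require Import generic_quotient ring_quotient complex.
From mathcomp Require Import all_classical all_reals all_analysis.
From mathcomp Require Import zify ring.
Local Open Scope classical_set_scope.

(** Write V1, V2 for the universal covers, L1, L2 for the lattices and n for the
    real dimension of V1.  The map f lifts to a complex linear map A from V1 to
    V2 ([analytic_repP]), so that ker f is the image in T1 of A^-1(L2).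

    Counting.  The Smith normal form of the integral matrix of A provides bases
    b1 of L1 and b2 of L2 such that A sends b1_i to d_i b2_i, with d_i nonzero,
    for i < r, and sends the other vectors of b1 to 0 ([stacked_bases]).  Both are
    also real bases of the universal covers.  In the real coordinates c of b1,
    A^-1(L2) is the set where c_i d_i is an integer for all i < r, and ker A is the
    set where c_i = 0 for all i < r.  Hence A^-1(L2) / (L1 + ker A) is the product
    of the groups Z / d_i, of order the product of the |d_i|.  Determinantal
    divisors are invariant under unimodular row and column operations
    ([det_divisor_unimodular]), so this order is the r-th one, and those of
    order k > r vanish.

    Topology.  The component of ker f through the image of v is the image of
    v + ker A ([torus_ker_componentE]): it is connected because it is a union of
    images of segments through v, and it is open and closed in ker f because every
    subset of the discrete group L2 is closed.  So the components of ker f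
    correspond to the elements of the quotient above
    ([card_torus_ker_components]).

    Dimension.  The component of 0 is thus the image of ker A.  The last n - r
    vectors of b1 are a basis of the lattice of ker A, which has real dimension
    n - r = 2 h; so r = 2 (g1 - h).  That a subtorus determines its dimension is a
    countability argument: if two subspaces have the same image in T1, each lies
    in the sum of the other and the countable group L1, whence in the other
    ([vspace_sub_mod_countable]).

    Degree.  If ker f is finite then ker A = 0 by the same countability argument,
    so r = n and the components of ker f are its points.  Conversely r = n makes
    ker A zero, so that the components are again points, and there are finitely
    many of them.  Hence r < n when ker f is infinite, and the n-th determinantal
    divisor is 0. *)

Set Implicit Arguments.
Unset Strict Implicit.
Unset Printing Implicit Defensive.

Import Order.TTheory GRing.Theory Num.Theory.
Import numFieldNormedType.Exports.

Local Open Scope ring_scope.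
Local Open Scope complex_scope.

(** * Determinantal divisors and the Smith normal form *)

(** Expansion by multilinearity in the rows of A *m B, which are combinations of
    the rows of B.  Keeping all maps phi, injective or not, avoids grouping the
    terms into the minors of the Cauchy-Binet formula; for divisibility this
    form suffices. *)
Lemma det_mulmx_rect (K : comNzRingType) (k m : nat)
    (A : 'M[K]_(k, m)) (B : 'M[K]_(m, k)) :
  \det (A *m B) =
  \sum_(phi : {ffun 'I_k -> 'I_m}) (\prod_i A i (phi i)) * \det (rowsub phi B).
Proof.
transitivity (\sum_(s : 'S_k) \sum_(phi : {ffun 'I_k -> 'I_m})
    (-1) ^+ s * \prod_i (A i (phi i) * B (phi i) (s i))).
  apply: eq_bigr => s _; rewrite -big_distrr /=; congr (_ * _).
  rewrite -(bigA_distr_bigA (fun i j => A i j * B j (s i))) /=.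
  by apply: eq_bigr => i _; rewrite mxE.
rewrite exchange_big; apply: eq_bigr => phi _ /=.
rewrite /(\det _) big_distrr /=; apply: eq_bigr => s _.
rewrite big_split /= mulrCA; congr (_ * (_ * _)).
by apply: eq_bigr => i _; rewrite mxE.
Qed.

(** Turns a minor with arbitrary distinct rows into one with increasing rows. *)
Lemma sorting_perm (k m : nat) (s : 'I_k -> 'I_m) : injective s ->
  exists p : 'S_k, increasing_ffun [ffun i => s (p i)].
Proof.
move=> s_inj; pose t := [tuple (s i : nat) | i < k].
have /tuple_permP[p tp] : perm_eq (sort leq t) t by rewrite perm_sort.
exists p; apply/forallP => i; apply/forallP => j; apply/implyP => ltij.
rewrite !ffunE.
have val_sort l : nth 0%N (sort leq t) (l : 'I_k) = s (p l).
  rewrite tp -(tnth_nth 0%N [tuple tnth t (p i) | i < k]).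
  by rewrite !tnth_mktuple.
have: sorted ltn (sort leq t).
  rewrite ltn_sorted_uniq_leq sort_uniq sort_sorted; last exact: leq_total.
  rewrite andbT map_inj_uniq ?enum_uniq // => a b /val_inj; exact: s_inj.
move/(sorted_ltn_nth ltn_trans 0%N)/(_ i j); rewrite !inE !val_sort; apply=> //;
  by rewrite size_sort size_tuple.
Qed.

Lemma absz_sign (b : bool) : `|((-1) ^+ b : int)|%N = 1%N.
Proof. by case: b. Qed.

(** The rows and columns may be repeated or unordered: repetitions give a zero
    determinant, and reordering only changes its sign. Together with
    [dvdn_det_divisorP] this characterizes determinantal divisors without any
    reference to increasing maps. *)
Lemma dvdn_det_divisor (m n : nat) (M : 'M[int]_(m, n)) (k : nat)
    (s : 'I_k -> 'I_m) (t : 'I_k -> 'I_n) :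
  (det_divisor M k %| `|\det (mxsub s t M)|)%N.
Proof.
have [/injectiveP s_inj|/injectivePn[i [j neq_ij eq_s]]] := boolP (injectiveb s);
  last by rewrite (determinant_alternate neq_ij) // => l; rewrite !mxE eq_s.
have [/injectiveP t_inj|/injectivePn[i [j neq_ij eq_t]]] := boolP (injectiveb t);
  last by rewrite -det_tr (determinant_alternate neq_ij) // => l;
    rewrite !mxE eq_t.
have [p incp] := sorting_perm s_inj; have [q incq] := sorting_perm t_inj.
have -> : `|\det (mxsub s t M)|%N =
    `|\det (mxsub [ffun i => s (p i)] [ffun i => t (q i)] M)|%N.
  have -> : mxsub [ffun i => s (p i)] [ffun i => t (q i)] M =
      row_perm p (col_perm q (mxsub s t M)).
    by apply/matrixP => i j; rewrite !mxE !ffunE.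
  rewrite row_permE col_permE !det_mulmx !det_perm !abszM !absz_sign.
  by rewrite mul1n muln1.
apply: dvdn_trans (biggcdn_inf _ incp (dvdnn _)) _.
exact: (biggcdn_inf _ incq (dvdnn _)).
Qed.

Lemma dvdn_det_divisorP (m n : nat) (M : 'M[int]_(m, n)) (k d : nat) :
  (forall (s : 'I_k -> 'I_m) (t : 'I_k -> 'I_n),
     (d %| `|\det (mxsub s t M)|)%N) ->
  (d %| det_divisor M k)%N.
Proof. by move=> dvd_d; apply/dvdn_biggcdP => s _; apply/dvdn_biggcdP => t _. Qed.

Lemma det_divisor_tr (m n : nat) (M : 'M[int]_(m, n)) (k : nat) :
  det_divisor M^T k = det_divisor M k.
Proof.
apply/eqP; rewrite eqn_dvd; apply/andP; split; apply: dvdn_det_divisorP => s t.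
  by rewrite -det_tr trmx_mxsub dvdn_det_divisor.
by rewrite -det_tr -trmx_mxsub trmxK dvdn_det_divisor.
Qed.

(** By [det_mulmx_rect], the minors of P *m M are integral combinations of
    minors of M of the same order. *)
Lemma dvdn_det_divisor_mull (p m n : nat) (P : 'M[int]_(p, m))
    (M : 'M[int]_(m, n)) (k : nat) :
  (det_divisor M k %| det_divisor (P *m M) k)%N.
Proof.
apply: dvdn_det_divisorP => s t.
have -> : mxsub s t (P *m M) = rowsub s P *m colsub t M.
  by apply/matrixP => i j; rewrite !mxE; apply: eq_bigr => l _; rewrite !mxE.
rewrite det_mulmx_rect -[det_divisor M k]absz_nat -dvdzE.
apply: rpred_sum => phi _; apply: dvdz_mull.
by rewrite -mxsub_comp dvdzE absz_nat dvdn_det_divisor.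
Qed.

Lemma dvdn_det_divisor_mulr (m n p : nat) (M : 'M[int]_(m, n))
    (P : 'M[int]_(n, p)) (k : nat) :
  (det_divisor M k %| det_divisor (M *m P) k)%N.
Proof.
by rewrite -(det_divisor_tr M) -(det_divisor_tr (M *m P)) trmx_mul
  dvdn_det_divisor_mull.
Qed.

Lemma det_divisor_unimodular (m n : nat) (L : 'M[int]_m) (M : 'M[int]_(m, n))
    (R : 'M[int]_n) (k : nat) :
  L \in unitmx -> R \in unitmx ->
  det_divisor (L *m M *m R) k = det_divisor M k.
Proof.
move=> uL uR; apply/eqP; rewrite eqn_dvd; apply/andP; split.
  rewrite -{2}[M](mulKmx uL) -{2}[L *m M](mulmxK uR).
  exact: (dvdn_trans (dvdn_det_divisor_mulr _ (invmx R) k)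
                     (dvdn_det_divisor_mull _ _ k)).
exact: (dvdn_trans (dvdn_det_divisor_mull L M k) (dvdn_det_divisor_mulr _ R k)).
Qed.

Lemma det_divisor_square (n : nat) (M : 'M[int]_n) :
  det_divisor M n = `|\det M|%N.
Proof.
apply/eqP; rewrite eqn_dvd; apply/andP; split.
  by have := dvdn_det_divisor M id id; rewrite mxsub_id.
apply: dvdn_det_divisorP => s t.
have -> : mxsub s t M = rowsub s 1%:M *m M *m colsub t 1%:M.
  by rewrite mul_rowsub_mx mul1mx mulmx_colsub mulmx1 -mxsub_comp.
by rewrite !det_mulmx !abszM dvdn_mulr ?dvdn_mull.
Qed.

Lemma det_divisor_gt (m n : nat) (M : 'M[int]_(m, n)) (k : nat) :
  (m < k)%N -> det_divisor M k = 0%N.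
Proof.
move=> lt_mk; apply/eqP; rewrite -dvd0n; apply: dvdn_det_divisorP => s t.
have [/injectiveP/leq_card|/injectivePn[i [j neq_ij eq_s]]] :=
  boolP (injectiveb s).
  by rewrite !card_ord leqNgt lt_mk.
by rewrite (determinant_alternate neq_ij) // => l; rewrite !mxE eq_s.
Qed.

(** D factors through the diagonal matrix, and conversely the diagonal matrix is
    extracted from D by the transposed factors; so [dvdn_det_divisor_mull] and
    [dvdn_det_divisor_mulr] reduce D to a square matrix, with no inspection of its
    minors. *)
Section DiagonalBlock.
Variables (r s' s : nat) (d : 'rV[int]_r).
Let D : 'M[int]_(r + s', r + s) := block_mx (diag_mx d) 0 0 0.

Let DE : D = col_mx 1%:M 0 *m diag_mx d *m row_mx 1%:M 0.
Proof.
by rewrite mul_col_mx mul1mx mul0mx mul_col_row mulmx1 mulmx0 !mul0mx.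
Qed.

Lemma det_divisor_diag_block : det_divisor D r = (\prod_i `|d ord0 i|)%N.
Proof.
have -> : (\prod_i `|d ord0 i|)%N = det_divisor (diag_mx d) r.
  rewrite det_divisor_square det_diag.
  by apply/esym/(big_morph absz abszM).
apply/eqP; rewrite eqn_dvd; apply/andP; split; last first.
  rewrite DE; apply: dvdn_trans (dvdn_det_divisor_mulr _ (row_mx 1%:M 0) r).
  exact: dvdn_det_divisor_mull.
have -> : diag_mx d = row_mx 1%:M 0 *m D *m col_mx 1%:M 0.
  rewrite /D mul_row_block !mulmx0 !addr0 mul1mx mul_row_col mulmx1.
  by rewrite mulmx0 addr0.
exact: (dvdn_trans (dvdn_det_divisor_mull _ D r) (dvdn_det_divisor_mulr _ _ r)).
Qed.

Lemma det_divisor_diag_block_gt (k : nat) : (r < k)%N -> det_divisor D k = 0%N.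
Proof.
move=> lt_rk; apply/eqP; rewrite -dvd0n DE -mulmxA.
have <- := det_divisor_gt (diag_mx d *m (row_mx 1%:M 0 : 'M[int]_(r, r + s))) lt_rk.
exact: dvdn_det_divisor_mull.
Qed.
End DiagonalBlock.

(** The divisibility chain of the invariant factors serves only to put the nonzero
    ones first. *)
Lemma Smith_block (m n : nat) (M : 'M[int]_(m, n)) :
  exists (r s' s : nat) (em : (r + s')%N = m) (en : (r + s)%N = n)
    (L : 'M[int]_m) (d : 'rV[int]_r) (R : 'M[int]_n),
  [/\ L \in unitmx, R \in unitmx, forall i, d 0 i != 0 &
      M = L *m castmx (em, en) (block_mx (diag_mx d) 0 0 0) *m R].
Proof.
have [L uL [R uR [d d_sorted ->]]] := int_Smith_normal_form M.
have ex_r : exists i, (minn m n <= i)%N || (d`_i == 0).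
  by exists (minn m n); rewrite leqnn.
have [r r_zero r_min] := ex_minnP ex_r.
have le_r : (r <= minn m n)%N by apply: r_min; rewrite leqnn.
have d_neq0 i : (i < r)%N -> d`_i != 0.
  move=> lt_ir; apply: contraL (lt_ir) => di0.
  by rewrite -leqNgt r_min ?di0 ?orbT.
have d_eq0 i : (r <= i)%N -> (i < minn m n)%N -> d`_i = 0.
  move=> le_ri lt_i; have [lt_id|] := ltnP i (size d); last exact: nth_default.
  have /eqP dr0 : d`_r == 0.
    by move: r_zero; rewrite leqNgt (leq_ltn_trans le_ri lt_i).
  have := sorted_leq_nth dvdz_trans dvdzz 0 d_sorted r i; rewrite !inE.
  move=> /(_ (leq_ltn_trans le_ri lt_id) lt_id le_ri).
  by rewrite dr0 dvd0z => /eqP.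
clear M ex_r r_zero r_min.
have em : (r + (m - r))%N = m by lia.
have en : (r + (n - r))%N = n by lia.
exists r, (m - r)%N, (n - r)%N, em, en, L, (\row_i d`_i), R.
split=> // [i|]; first by rewrite mxE d_neq0.
congr (_ *m _ *m _); clear L R uL uR.
(* The block sizes become variables so that the casts disappear. *)
move: (m - r)%N (n - r)%N em en => s' s em en; subst m n.
rewrite castmx_id; apply/matrixP => i j; rewrite mxE.
case: (split_ordP i) => i' ->; case: (split_ordP j) => j' ->.
- by rewrite block_mxEul !mxE.
- by rewrite block_mxEur !mxE /= ltn_eqF // ltn_addr.
- by rewrite block_mxEdl !mxE /= gtn_eqF // ltn_addr.
rewrite block_mxEdr !mxE /=; case: eqVneq => // eq_ij.
rewrite d_eq0 ?mul0rn ?leq_addr //.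
by rewrite leq_min ltn_add2l ltn_ord eq_ij ltn_add2l ltn_ord.
Qed.

(** * Real coordinates with respect to a basis of a lattice *)

Section RealCoordinates.
Context {R : realType} {V : normedVectType R[i]}.
Implicit Types (L : set V) (W : {vspace V}).

(** Real scalars act on a complex space through the embedding of R in R[i]. *)
Definition real_comb n (e : 'I_n -> V) (c : 'rV[R]_n) : V :=
  \sum_(i < n) (c 0 i)%:C *: e i.

Lemma real_combB n (e : 'I_n -> V) (c c' : 'rV[R]_n) :
  real_comb e (c - c') = real_comb e c - real_comb e c'.
Proof.
rewrite /real_comb -sumrB; apply: eq_bigr => i _.
by rewrite !mxE rmorphB scalerBl.
Qed.

Lemma real_comb_int n (e : 'I_n -> V) (z : 'I_n -> int) :
  real_comb e (\row_i (z i)%:~R) = \sum_(i < n) e i *~ z i.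
Proof.
by apply: eq_bigr => i _; rewrite mxE rmorph_int scaler_int.
Qed.

Lemma Zbasis_mem L n (e : 'I_n -> V) (i : 'I_n) : is_Zbasis L e -> L (e i).
Proof.
move=> [e_fun _ _]; have := e_fun (delta_mx i 0) I.
congr L; rewrite (bigD1 i) //= big1 ?addr0 ?mxE ?eqxx // => j neq_ji.
by rewrite !mxE (negPf neq_ji) mulr0z.
Qed.

Lemma real_span_Zbasis L n (e : 'I_n -> V) :
  is_Zbasis L e -> real_span L = range (real_comb e).
Proof.
move=> e_basis; apply/seteqP; split=> v /=.
  have [_ _ e_surj] := e_basis.
  move=> [k [c [l [Ll ->]]]].
  have {Ll} ex_z j := e_surj _ (Ll j).
  pose z j := sval (cid2 (ex_z j)).
  have lE j : l j = \sum_(i < n) e i *~ z j i 0 by rewrite /z; case: cid2.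
  exists (\row_i \sum_(j < k) c j * (z j i 0)%:~R) => //.
  rewrite /real_comb; under eq_bigr do rewrite mxE rmorph_sum scaler_suml.
  rewrite exchange_big; apply: eq_bigr => j _ /=.
  rewrite lE scaler_sumr; apply: eq_bigr => i _.
  by rewrite rmorphM rmorph_int -scalerA scaler_int.
move=> [c _ <-]; exists n, (c 0), e; split=> // i; exact: (Zbasis_mem i e_basis).
Qed.

(** The real and imaginary parts rho of the complex coordinates identify W with
    R^(2 dim W), with inverse sigma; families of vectors of W then become real
    matrices, and their rank decides injectivity. *)
Section Coordinates.
Variable W : {vspace V}.
Let d := \dim W.
Let rho (v : V) : 'rV[R]_(d + d) :=
  row_mx (\row_i complex.Re (coord (vbasis W) i v))
         (\row_i complex.Im (coord (vbasis W) i v)).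
Let sigma (x : 'rV[R]_(d + d)) : V :=
  \sum_(i < d) (lsubmx x 0 i +i* rsubmx x 0 i) *: (vbasis W)`_i.

Let rhoK v : v \in W -> sigma (rho v) = v.
Proof.
move=> Wv; rewrite [RHS](coord_vbasis Wv); apply: eq_bigr => i _.
by rewrite row_mxKl row_mxKr !mxE; case: (coord _ _ _).
Qed.

Let sigma_mem x : sigma x \in W.
Proof.
by apply: rpred_sum => i _; rewrite rpredZ ?vbasis_mem ?mem_nth ?size_tuple.
Qed.

Let sigmaK : cancel sigma rho.
Proof.
move=> x; rewrite -[RHS]hsubmxK /rho; congr row_mx; apply/rowP => i;
  by rewrite mxE /sigma coord_sum_free // (basis_free (vbasisP W)).
Qed.

Let rho_real_comb n (e : 'I_n -> V) (c : 'rV[R]_n) :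
  rho (real_comb e c) = c *m \matrix_i rho (e i).
Proof.
apply/rowP => j; rewrite [RHS]mxE /rho.
case: (split_ordP j) => k ->; rewrite (row_mxEl, row_mxEr) mxE linear_sum;
  rewrite raddf_sum; apply: eq_bigr => i _;
  rewrite mxE (row_mxEl, row_mxEr) mxE linearZ /=;
  case: (coord _ _ _) => a b /=; ring.
Qed.

Lemma real_comb_inj_dim n (e : 'I_n -> V) :
  range (real_comb e) = [set` W] -> injective (real_comb e) <-> n = (2 * d)%N.
Proof.
move=> e_range; pose B := \matrix_i rho (e i).
have combE c : real_comb e c = sigma (c *m B).
  rewrite -rho_real_comb rhoK //.
  by have : range (real_comb e) (real_comb e c); [exists c | rewrite e_range].
have /eqP rankB : row_full B.
  rewrite -sub1mx; apply/row_subP => i.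
  have : [set` W] (sigma (row i 1%:M)) by exact: sigma_mem.
  rewrite -e_range => -[c _ ]; rewrite combE => /(can_inj sigmaK) <-.
  exact: submxMl.
split=> [e_inj|eq_n].
  have /eqP : row_free B.
    apply: inj_row_free => c cB0; apply: e_inj.
    by rewrite !combE cB0 mul0mx.
  by rewrite rankB => <-; rewrite mul2n addnn.
have freeB : row_free B by rewrite /row_free rankB eq_n addnn mul2n.
move=> c c'; rewrite !combE => /(can_inj sigmaK).
exact: row_free_inj.
Qed.
End Coordinates.

Lemma mem_Zbasis_real_comb L n (e : 'I_n -> V) (c : 'rV[R]_n) :
  is_Zbasis L e -> injective (real_comb e) ->
  L (real_comb e c) <-> exists z : 'I_n -> int, c = \row_i (z i)%:~R.
Proof.
move=> [e_fun _ e_surj] e_inj; split=> [|[z ->]].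
  move=> /e_surj[z _]; rewrite -(real_comb_int e (fun i => z i 0)).
  by move=> /e_inj <-; exists (fun i => z i 0).
rewrite real_comb_int; have := e_fun (\col_i z i) I.
by congr L; apply: eq_bigr => i _; rewrite mxE.
Qed.

Lemma Zbasis_unimodular L n (e : 'I_n -> V) (P : 'M[int]_n) :
  is_Zbasis L e -> P \in unitmx ->
  is_Zbasis L (fun j => \sum_i e i *~ P i j).
Proof.
move=> [e_fun e_inj e_surj] uP.
have combE (z : 'cV[int]_n) :
    \sum_j (\sum_i e i *~ P i j) *~ z j 0 = \sum_i e i *~ (P *m z) i 0.
  under eq_bigr do rewrite mulrz_suml.
  rewrite exchange_big; apply: eq_bigr => i _ /=; rewrite mxE mulrz_sumr.
  by apply: eq_bigr => j _; rewrite mulrzA.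
split=> [z _ | z z' _ _ | l Ll] /=.
- by rewrite combE; apply: e_fun.
- rewrite !combE => /e_inj; rewrite !inE => /(_ I I) eq_P.
  by rewrite -(mulKmx uP z) eq_P mulKmx.
have [z _ <-] := e_surj _ Ll; exists (invmx P *m z) => //.
by rewrite combE mulKVmx.
Qed.

End RealCoordinates.

Lemma Zcoord_Zbasis (R : realType) (V : normedVectType R[i]) (L : set V) n
    (e : 'I_n -> V) (l : V) :
  is_Zbasis L e -> L l -> l = \sum_i e i *~ Zcoord e l i 0.
Proof.
move=> [_ _ e_surj] /e_surj[z _ zl]; rewrite /Zcoord.
by case: xgetP => [z' _ //|/(_ z) []]; rewrite /= zl.
Qed.

(** * Discrete subgroups, countable subgroups and real lines *)

Section Discrete.
Context {R : realType} {V : normedVectType R[i]}.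

(** A countable set has Lebesgue measure 0, but the unit interval has
    measure 1. *)
Lemma uncountable_reals : ~ countable [set: R].
Proof.
move=> R_count; have := @countable_lebesgue_measure0 R `[0, 1]%classic.
have -> : countable (`[0%R, 1%R]%classic : set R).
  by apply: sub_countable R_count; apply: subset_card_le.
move=> /(_ isT); rewrite lebesgue_measure_itv /= lte_fin ltr01.
by move/eqP; rewrite -EFinD eqe subr0 oner_eq0.
Qed.

(** If v in W1 is not in W2, the points of the real line through v are distinct
    modulo W2, so the elements of L that correct them are distinct too: an
    uncountable subset of L.  For W2 = 0 this says that a subspace contained in a
    countable set is zero. *)
Lemma vspace_sub_mod_countable (W1 W2 : {vspace V}) L :
  countable L ->
  (forall v, v \in W1 -> exists2 l, L l & v - l \in W2) -> (W1 <= W2)%VS.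
Proof.
move=> /countable_injP[code code_inj] W1_sub; apply/subvP => v W1v.
apply: contrapT => /negP W2'v; apply: uncountable_reals; apply/countable_injP.
have ex_l (t : R) : exists2 l, L l & t%:C *: v - l \in W2.
  by apply: W1_sub; rewrite rpredZ.
pose l t := sval (cid2 (ex_l t)).
have Ll t : L (l t) by rewrite /l; case: cid2.
have W2l t : t%:C *: v - l t \in W2 by rewrite /l; case: cid2.
exists (code \o l) => t u _ _ /= /code_inj; rewrite !inE => /(_ (Ll t) (Ll u)).
move=> eq_l; apply/eqP; rewrite -subr_eq0; apply: contraNT W2'v => tu_neq0.
have tu_neq0' : (t - u)%:C != 0 :> R[i] by rewrite (fmorph_eq0 (real_complex R)).
rewrite -(scalerK tu_neq0' v) rpredZ // rmorphB scalerBl.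
have := rpredB (W2l t) (W2l u).
by rewrite eq_l opprB addrA addrNK.
Qed.

Lemma Zbasis_countable L n (e : 'I_n -> V) : is_Zbasis L e -> countable L.
Proof.
move=> [_ _ e_surj]; apply: (sub_countable (subset_card_le e_surj)).
apply: (card_le_trans (card_image_le _ _)).
exact: countableP.
Qed.

(** Near any p, two elements of S differ by an element of L close to 0, so they
    are equal; a limit point of S is therefore a point of S. *)
Lemma closed_sub_discrete (L : zmodClosed V) (S : set V) :
  [set` L] `<=` isolated [set` L] -> S `<=` [set` L] -> closed S.
Proof.
move=> L_discr SL p p_clos.
have [_ [U U_nbhs UL]] := L_discr 0 (rpred0 _).
have subpp : nbhs ((fun x : V * V => x.1 - x.2) (p, p)) U by rewrite /= subrr.
have [[A B] /= [A_nbhs B_nbhs] ABU] := sub_continuous subpp.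
have [s [Ss [As Bs]]] := p_clos _ (filterI A_nbhs B_nbhs).
have [->//|neq_ps] := eqVneq p s.
have s'_nbhs : nbhs p (~` [set s]).
  apply: open_nbhs_nbhs; split; last exact/eqP.
  apply: closed_openC; apply: accessible_closed_set1.
  exact/hausdorff_accessible/norm_hausdorff.
have [s' [Ss' [[As' Bs'] /= neq_s's]]] :=
  p_clos _ (filterI (filterI A_nbhs B_nbhs) s'_nbhs).
have : (U `&` [set` L]) (s' - s).
  split; first by apply: (ABU (s', s)).
  by rewrite /= rpredB //; exact: SL.
by rewrite UL => /eqP; rewrite subr_eq0 => /eqP.
Qed.

End Discrete.

Lemma subset_isolated (T : topologicalType) (A B : set T) :
  A `<=` B -> B `<=` isolated B -> A `<=` isolated A.
Proof.
move=> AB B_iso x Ax; have [_ [U U_nbhs UB]] := B_iso _ (AB _ Ax).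
split; first exact/mem_set.
exists U => //; apply/seteqP; split=> y /=.
  by move=> [Uy Ay]; rewrite -[y = x]/([set x] y) -UB; split=> //; exact: AB.
move=> ->; split=> //; exact: nbhs_singleton.
Qed.

Section RealLine.
Context {R : realType} {V : normedVectType R[i]}.

Lemma real_complex_continuous :
  continuous (fun t : R => t%:C : (R[i] : numFieldType)).
Proof.
move=> t; apply/cvgrPdist_lt => eps eps_gt0.
have eps_real : (complex.Re eps)%:C = eps by rewrite RRe_real ?gtr0_real.
have Re_gt0 : 0 < complex.Re eps by rewrite -(ltcR 0) eps_real.
near=> u.
have : `|t - u| < complex.Re eps by near: u; exact: cvgr_dist_lt.
by rewrite -rmorphB normc_def /= expr0n addr0 sqrtr_sqr -{2}eps_real ltcR.
Unshelve. all: by end_near. Qed.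

Lemma real_line_continuous (v w : V) : continuous (fun t : R => v + t%:C *: w).
Proof.
move=> t; apply: cvgD; first exact: cvg_cst.
apply: cvgZr_tmp; exact: real_complex_continuous.
Qed.
End RealLine.

(** * The projection onto a torus *)

Section Projection.
Context {R : realType} (T : complex_torus R).
Local Notation pi := (@torus_pi R T).

Lemma torus_pi_eq v w : pi v = pi w <-> v - w \in lattice T.
Proof.
rewrite (Quotient.idealrBE (lattice T) v w); split=> [eq_pi|/eqP //].
exact/eqP.
Qed.

Lemma torus_piD : {morph pi : v w / v + w}.
Proof. by move=> v w; rewrite /torus_pi !piE. Qed.

Lemma torus_pi0 : pi 0 = 0.
Proof. by rewrite /torus_pi !piE. Qed.

Lemma torus_pi_eq0 v : pi v = 0 <-> v \in lattice T.
Proof. by rewrite -torus_pi0 torus_pi_eq subr0. Qed.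

Lemma torus_piMn v n : pi (v *+ n) = pi v *+ n.
Proof. by elim: n => [|n IHn]; rewrite ?torus_pi0 // !mulrS torus_piD IHn. Qed.

Lemma torus_pi_surj x : exists v, x = pi v.
Proof. by exists (repr x); rewrite /torus_pi reprK. Qed.

Lemma torus_pi_continuous : continuous pi.
Proof. exact: pi_continuous. Qed.

(** The topology of a torus is the quotient topology. *)
Lemma closed_torus (C : set T) : closed (pi @^-1` C) -> closed C.
Proof. by move=> C_closed; rewrite -openC; apply: (closed_openC C_closed). Qed.

Lemma lattice_isolated : [set` lattice T] `<=` isolated [set` lattice T].
Proof. by case: (latticeP T). Qed.

Lemma lattice_countable : countable [set` lattice T].
Proof. by case: (latticeP T) => _ [e /Zbasis_countable]. Qed.

Lemma lattice_real_comb_range n (e : 'I_n -> universal_cover T) :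
  is_Zbasis [set` lattice T] e -> range (real_comb e) = [set` fullv].
Proof. by move/real_span_Zbasis <-; case: (latticeP T). Qed.
End Projection.

(** A family of 2 g vectors spanning a real space of dimension 2 g is free. *)
Lemma lattice_real_comb_inj (R : realType) (T : complex_torus R) (n : nat)
    (e : 'I_n -> universal_cover T) :
  is_Zbasis [set` lattice T] e -> n = (2 * torus_dim T)%N ->
  injective (real_comb e).
Proof.
by move=> e_basis eq_n; apply/(real_comb_inj_dim (lattice_real_comb_range e_basis)).
Qed.

(** Two subspaces with the same image in the torus are equal, each being
    contained in the other modulo the countable lattice. *)
Lemma subtorus_dimE (R : realType) (T : complex_torus R)
    (W : {vspace universal_cover T}) :
  is_lattice W ([set` W] `&` [set` lattice T]) ->
  subtorus_dim (@torus_pi R T @` [set` W]) = \dim W.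
Proof.
move=> W_lattice; rewrite /subtorus_dim.
have sub (W1 W2 : {vspace universal_cover T}) :
    @torus_pi R T @` [set` W1] = @torus_pi R T @` [set` W2] -> (W1 <= W2)%VS.
  move=> eqW; apply: (vspace_sub_mod_countable (lattice_countable T)) => v W1v.
  have : (@torus_pi R T @` [set` W2]) (torus_pi v) by rewrite -eqW; exists v.
  move=> [w /= W2w /esym/torus_pi_eq vw]; exists (v - w) => //.
  by rewrite opprB addrC subrK.
case: xgetP => [_ -> [W' [_ eqW <-]]|/(_ (\dim W)) []]; last by exists W.
by congr (\dim _); apply/eqP; rewrite eqEsubv !sub.
Qed.

(** * The analytic representation and the components of the kernel *)

Section Hom.
Context {R : realType} {T1 T2 : complex_torus R} (f : torus_hom T1 T2).
Local Notation V1 := (universal_cover T1).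
Local Notation V2 := (universal_cover T2).

Local Notation A := (analytic_rep f).

Lemma torus_hom0 : f 0 = 0.
Proof. by apply: (addrI (f 0)); rewrite -torus_homD !addr0. Qed.

Lemma torus_homMn x n : f (x *+ n) = f x *+ n.
Proof. by elim: n => [|n IHn]; rewrite ?torus_hom0 // !mulrS torus_homD IHn. Qed.

(** Let F be a holomorphic lift of f near 0 and y a point of V2 above
    f (torus_pi w).  As f is additive, n (F (w / n) - F 0) lies above f (torus_pi w)
    for n large, that is, in the closed set y + L2.  Its limit is the derivative of F
    at 0 along w, which thus also lies above f (torus_pi w). *)
Lemma torus_hom_lift : exists D : {linear V1 -> V2},
  continuous D /\ forall v, f (torus_pi v) = torus_pi (D v).
Proof.
have [F F_lift] := torus_hom_holomorphic f 0.
have [F_diff F0] := nbhs_singleton F_lift.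
exists ('d F (0 : V1)); split; first exact: diff_continuous.
move=> w; have [y fy] := torus_pi_surj (f (torus_pi w)).
pose h n : (R[i] : numFieldType) := (harmonic n : R)%:C.
have h_cvg : h @ \oo --> (0 : R[i] : numFieldType).
  have := cvg_comp _ _ (@cvg_harmonic R) (@real_complex_continuous R 0).
  exact.
have h_neq0 n : h n != 0.
  by rewrite (fmorph_eq0 (real_complex R)) invr_eq0 pnatr_eq0.
have hV n : (h n)^-1 = n.+1%:R.
  by rewrite /h /harmonic fmorphV invrK rmorph_nat.
pose q n : V2 := (h n)^-1 *: (F (h n *: w + 0) - F 0).
have q_cvg : q @ \oo --> 'd F (0 : V1) w.
  rewrite -deriveE //.
  apply: (cvg_comp _ (fun k => k^-1 *: ((F \o shift 0) (k *: w) - F 0)) _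
            (diff_derivable (v := w) F_diff)).
  move=> U [e /= e_gt0 eU].
  have h_ball : \forall n \near \oo, `|0 - h n| < e.
    by move/cvgrPdist_lt: h_cvg => /(_ e e_gt0).
  change (\forall n \near \oo, U (h n)).
  by apply: filterS h_ball => n hn_ball; apply: eU => //; exact: h_neq0.
have lift_near : \forall n \near \oo,
    f (torus_pi (h n *: w)) = torus_pi (F (h n *: w)).
  have hw_cvg : (fun n => 0 + h n *: w) @ \oo --> (0 : V1).
    have := cvg_comp _ _ (@cvg_harmonic R) (@real_line_continuous _ _ (0 : V1) w 0).
    by rewrite scale0r addr0.
  have := hw_cvg _ F_lift.
  rewrite nbhs_filterE nearE /fmap /=.
  by apply: filterS => n /= [_]; rewrite add0r.
rewrite fy; apply/torus_pi_eq; rewrite -opprB rpredN.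
have lattice_closed : closed [set` lattice T2].
  by apply: (closed_sub_discrete (@lattice_isolated _ T2)).
suff near_lattice : \forall n \near \oo, [set` lattice T2] (q n - y).
  exact: (closed_cvg _ lattice_closed near_lattice _ (cvgB q_cvg (cvg_cst y))).
apply: filterS lift_near => n /= lift_n.
apply/torus_pi_eq; rewrite -fy /q addr0 hV scaler_nat.
rewrite torus_piMn.
have -> : torus_pi (F (h n *: w) - F 0) = f (torus_pi (h n *: w)).
  apply: (addIr (torus_pi (F 0))).
  by rewrite -torus_piD addrNK -lift_n -F0 torus_pi0 torus_hom0 addr0.
rewrite -torus_homMn -torus_piMn -scaler_nat -hV scalerA.
by rewrite mulVf ?scale1r ?h_neq0.
Qed.

Lemma analytic_repP v : f (torus_pi v) = torus_pi (analytic_rep f v).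
Proof.
rewrite /analytic_rep; case: xgetP => [B _ //|no_rep].
have [D [_ fD]] := torus_hom_lift.
by exfalso; apply: (no_rep (linfun D)) => u; rewrite lfunE.
Qed.

(** Two linear maps inducing f differ by a linear map with values in the countable
    lattice of T2, hence agree.  So the analytic representation is the differential
    of a local lift, and is continuous for that reason. *)
Lemma analytic_rep_continuous : continuous (analytic_rep f).
Proof.
have [D [D_cont fD]] := torus_hom_lift.
suff -> : (analytic_rep f : V1 -> V2) = D by [].
apply/funext => v; apply/eqP; rewrite -subr_eq0; apply/eqP.
set w := _ - _.
have w_lattice (k : R[i]) : k *: w \in lattice T2.
  apply/torus_pi_eq0; rewrite /w scalerBr -!linearZ.
  apply: (addIr (torus_pi (D (k *: v)))).
  by rewrite -torus_piD addrNK add0r -analytic_repP fD.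
have : (<[w]> <= 0)%VS.
  apply: (vspace_sub_mod_countable (lattice_countable T2)) => u /vlineP[k ->].
  by exists (k *: w); rewrite ?subrr ?mem0v //=; exact: w_lattice.
by rewrite subv0 => /eqP w0; apply/eqP; rewrite -memv0 -w0 memv_line.
Qed.

Lemma torus_ker_pi v : torus_ker f (torus_pi v) <-> A v \in lattice T2.
Proof. by rewrite /torus_ker /= analytic_repP torus_pi_eq0. Qed.

Lemma analytic_rep_lattice l : l \in lattice T1 -> A l \in lattice T2.
Proof.
move=> /torus_pi_eq0 l0; apply/torus_ker_pi.
by rewrite l0 /torus_ker /= torus_hom0.
Qed.

(** Connectedness of the right-hand side comes from segments in v + ker A.  It is
    also open and closed in ker f: above it and above its complement in ker f lie
    preimages, under the continuous map A, of subsets of the lattice of T2, which are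
    all closed. *)
Lemma torus_ker_componentE v : analytic_rep f v \in lattice T2 ->
  connected_component (torus_ker f) (torus_pi v) =
  @torus_pi R T1 @` [set u | analytic_rep f u = analytic_rep f v].
Proof.
move=> Av; set S := _ @` _.
have ker_v : torus_ker f (torus_pi v) by apply/torus_ker_pi.
apply/seteqP; split=> x.
  move=> [B [Bv B_ker B_conn] Bx].
  pose other := torus_ker f `\` S.
  have preE (P : set V2) : P `<=` [set` lattice T2] -> closed (A @^-1` P).
    move=> PL; apply: closed_comp => [? _|]; first exact: analytic_rep_continuous.
    exact: closed_sub_discrete (@lattice_isolated _ T2) PL.
  have piS u : S (torus_pi u) <-> exists2 l, l \in lattice T1 & A u = A v + A l.
    split=> [[u' /= Au' /esym/torus_pi_eq uu']|[l Ll Au]].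
      by exists (u - u') => //; rewrite -Au' -linearD addrC subrK.
    exists (u - l); first by rewrite /= linearB /= Au addrK.
    by apply/torus_pi_eq; rewrite addrAC subrr add0r rpredN.
  have S_closed : closed S.
    apply: closed_torus.
    suff -> : @torus_pi R T1 @^-1` S =
        A @^-1` [set A v + A l | l in [set` lattice T1]].
      by apply: preE => _ [l Ll <-] /=; rewrite rpredD // analytic_rep_lattice.
    apply/seteqP; split=> u /=; first by move=> /piS[l Ll ->]; exists l.
    by move=> [l Ll Au]; apply/piS; exists l.
  have other_closed : closed other.
    apply: closed_torus.
    suff -> : @torus_pi R T1 @^-1` other =
        A @^-1` ([set` lattice T2] `\` [set A v + A l | l in [set` lattice T1]]).
      by apply: preE => u [].
    apply/seteqP; split=> u [/torus_ker_pi Au nS]; split=> //.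
      by move=> [l Ll Al]; apply: nS; apply/piS; exists l.
    by move=> /piS[l Ll Al]; apply: nS; exists l.
  suff BS : B `&` S = B by have [] : (B `&` S) x by rewrite BS.
  apply: B_conn.
  - by exists (torus_pi v); split=> //; exists v.
  - exists (~` other); first exact: closed_openC.
    apply/seteqP; split=> y [By Sy]; split=> //; first by case.
    by apply: contrapT => nSy; apply: Sy; split=> //; exact: B_ker.
  - by exists S.
move=> [u /= Au <-].
pose line t : T1 := torus_pi (v + t%:C *: (u - v)).
apply: (@connected_component_max _ _ (line @` `[0, 1]%classic)).
- by exists 0; rewrite /line ?scale0r ?addr0 //= in_itv /= lexx ler01.
- move=> _ [t _ <-]; apply/torus_ker_pi.
  by rewrite linearD linearZ linearB /= Au subrr scaler0 addr0.
- apply: connected_continuous_connected; first exact: segment_connected.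
  apply: continuous_subspaceT => t.
  apply: (@continuous_comp _ _ _ (fun t : R => v + t%:C *: (u - v))).
    exact: real_line_continuous.
  exact: torus_pi_continuous.
- by exists 1; rewrite /line ?scale1r 1?addrC ?subrK //= in_itv /= lexx ler01.
Qed.

Lemma torus_ker0E : torus_ker0 f = @torus_pi R T1 @` [set` lker A].
Proof.
rewrite /torus_ker0 -torus_pi0 torus_ker_componentE ?linear0 ?rpred0 //.
by congr (_ @` _); apply/seteqP; split=> u /=; rewrite memv_ker => /eqP.
Qed.

Lemma torus_ker_component_eq v w :
  analytic_rep f v \in lattice T2 -> analytic_rep f w \in lattice T2 ->
  connected_component (torus_ker f) (torus_pi v) =
  connected_component (torus_ker f) (torus_pi w) <->
  exists2 l, l \in lattice T1 & v - w - l \in lker (analytic_rep f).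
Proof.
move=> Av Aw; split=> [eq_comp|[l Ll]].
  have : connected_component (torus_ker f) (torus_pi w) (torus_pi v).
    by rewrite -eq_comp; apply: connected_component_refl; apply/torus_ker_pi.
  rewrite torus_ker_componentE // => -[u /= Au /esym/torus_pi_eq uv].
  exists (v - u) => //; rewrite memv_ker !linearB /= Au.
  by rewrite -opprD subrr.
rewrite memv_ker !linearB /= => /eqP/subr0_eq Avw.
apply: same_connected_component.
rewrite torus_ker_componentE //; exists (w + l).
  by rewrite /= linearD /= -Avw addrC subrK.
by apply/torus_pi_eq; rewrite addrAC subrr add0r.
Qed.
End Hom.

(** * Bases of the lattices adapted to a linear map *)

(** If M = L D Q is the Smith normal form of the matrix of A, the bases e1 Q^-1
    and e2 L have matrix D. *)
Lemma stacked_bases (R : realType) (V1 V2 : normedVectType R[i])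
    (A : 'Hom(V1, V2)) (L1 : set V1) (L2 : set V2) (m n : nat)
    (e1 : 'I_n -> V1) (e2 : 'I_m -> V2) (M : 'M[int]_(m, n)) :
  is_Zbasis L1 e1 -> is_Zbasis L2 e2 ->
  (forall j, A (e1 j) = \sum_i e2 i *~ M i j) ->
  exists (r s' s : nat) (d : 'I_r -> int)
    (b1 : 'I_(r + s) -> V1) (b2 : 'I_(r + s') -> V2),
  [/\ [/\ (r + s)%N = n, (r + s')%N = m, is_Zbasis L1 b1 & is_Zbasis L2 b2],
      [/\ forall i, d i != 0,
          forall i, A (b1 (lshift s i)) = b2 (lshift s' i) *~ d i
        & forall i, A (b1 (rshift r i)) = 0],
      det_divisor M r = (\prod_i `|d i|)%N
    & forall k, (r < k)%N -> det_divisor M k = 0%N].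
Proof.
move=> e1_basis e2_basis Ae.
have [r [s' [s [em [en [L [d [Q [uL uQ d_neq0 defM]]]]]]]]] := Smith_block M.
subst m n; rewrite castmx_id in defM.
exists r, s', s, (d ord0), (fun j => \sum_i e1 i *~ invmx Q i j),
  (fun j => \sum_i e2 i *~ L i j).
have Ab j : A (\sum_i e1 i *~ invmx Q i j) =
    \sum_i e2 i *~
      (L *m block_mx (diag_mx d) 0 0 0 : 'M[int]_(r + s', r + s)) i j.
  have -> : L *m block_mx (diag_mx d) 0 0 0 = M *m invmx Q by rewrite defM mulmxK.
  rewrite linear_sum; under eq_bigr do rewrite raddfMz /= Ae mulrz_suml.
  rewrite exchange_big; apply: eq_bigr => i _ /=; rewrite mxE mulrz_sumr.
  by apply: eq_bigr => k _; rewrite mulrzA.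
split=> //.
- by split=> //; apply: Zbasis_unimodular; rewrite ?unitmx_inv.
- split=> // i; rewrite Ab.
    rewrite mulrz_suml; apply: eq_bigr => k _; rewrite mxE big_split_ord /=.
    rewrite [X in _ + X]big1 => [|l _]; last by rewrite block_mxEdl mxE mulr0.
    rewrite addr0 (bigD1 i) //= big1 => [|l neq_li].
      by rewrite block_mxEul !mxE eqxx addr0 mulrzA.
    by rewrite block_mxEul !mxE (negPf neq_li) mulr0.
  rewrite big1 // => k _; rewrite mxE big_split_ord /=.
  rewrite !big1 ?addr0 // => l _; last by rewrite block_mxEur mxE mulr0.
  by rewrite block_mxEdr mxE mulr0.
- by rewrite defM det_divisor_unimodular ?det_divisor_diag_block.
- move=> k lt_rk.
  by rewrite defM det_divisor_unimodular ?det_divisor_diag_block_gt.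
Qed.

Section Stacked.
Context {R : realType} {V1 V2 : normedVectType R[i]}.
Variables (A : 'Hom(V1, V2)) (L1 : set V1) (L2 : set V2) (r s' s : nat).
Variables (d : 'I_r -> int) (b1 : 'I_(r + s) -> V1) (b2 : 'I_(r + s') -> V2).
Hypotheses (b1_basis : is_Zbasis L1 b1) (b2_basis : is_Zbasis L2 b2).
Hypotheses (b1_range : range (real_comb b1) = [set` fullv]).
Hypotheses (b1_inj : injective (real_comb b1))
           (b2_inj : injective (real_comb b2)).
Hypotheses (d_neq0 : forall i, d i != 0).
Hypothesis Ab_l : forall i, A (b1 (lshift s i)) = b2 (lshift s' i) *~ d i.
Hypothesis Ab_r : forall i, A (b1 (rshift r i)) = 0.

Lemma stacked_real_comb (c : 'rV[R]_(r + s)) :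
  A (real_comb b1 c) =
  real_comb b2 (row_mx (\row_i (c 0 (lshift s i) * (d i)%:~R)) 0).
Proof.
rewrite /real_comb linear_sum !big_split_ord /=.
rewrite [X in _ + X]big1 => [|i _]; last by rewrite linearZ /= Ab_r scaler0.
rewrite [X in _ = _ + X]big1 => [|i _]; last by rewrite row_mxEr mxE scale0r.
congr (_ + _); apply: eq_bigr => i _.
rewrite linearZ /= Ab_l row_mxEl mxE rmorphM rmorph_int -scalerA.
by rewrite scaler_int.
Qed.

Lemma stacked_mem (c : 'rV[R]_(r + s)) :
  L2 (A (real_comb b1 c)) <->
  forall i, exists z : int, c 0 (lshift s i) * (d i)%:~R = z%:~R.
Proof.
rewrite stacked_real_comb mem_Zbasis_real_comb //; split=> [[z cz] i|ex_z].
  exists (z (lshift s' i)); move/rowP: cz => /(_ (lshift s' i)).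
  by rewrite row_mxEl !mxE.
have [z cz] := choice ex_z.
exists (fun k : 'I_(r + s') =>
  match fintype.split k with inl i => z i | inr _ => 0 end).
apply/rowP => k; rewrite [RHS]mxE; case: split_ordP => i ->.
  by rewrite row_mxEl mxE cz.
by rewrite row_mxEr mxE.
Qed.

Lemma stacked_ker (c : 'rV[R]_(r + s)) :
  real_comb b1 c \in lker A <-> forall i, c 0 (lshift s i) = 0.
Proof.
have comb0 : real_comb b2 0 = 0.
  by rewrite /real_comb big1 // => i _; rewrite mxE scale0r.
rewrite memv_ker stacked_real_comb -comb0; split=> [/eqP/b2_inj cd i|c0].
  move/rowP: cd => /(_ (lshift s' i)); rewrite row_mxEl !mxE => /eqP.
  by rewrite mulf_eq0 intr_eq0 (negPf (d_neq0 i)) orbF => /eqP.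
apply/eqP; congr (real_comb _ _); apply/rowP => k; rewrite [RHS]mxE.
by case: (split_ordP k) => i ->; rewrite (row_mxEl, row_mxEr) !mxE // c0 mul0r.
Qed.

Let real_comb_rshift (c : 'rV[R]_s) :
  real_comb (fun i => b1 (rshift r i)) c = real_comb b1 (row_mx 0 c).
Proof.
rewrite /real_comb [RHS]big_split_ord /= [X in _ = X + _]big1 ?add0r => [|i _].
  by apply: eq_bigr => i _; rewrite row_mxEr.
by rewrite row_mxEl mxE scale0r.
Qed.

Lemma stacked_ker_range :
  range (real_comb (fun i => b1 (rshift r i))) = [set` lker A].
Proof.
apply/seteqP; split=> v /=.
  move=> [c _ <-]; rewrite real_comb_rshift stacked_ker => i.
  by rewrite row_mxEl mxE.
have : range (real_comb b1) v by rewrite b1_range /= memvf.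
move=> [c _ <-]; rewrite stacked_ker => c0; exists (rsubmx c) => //.
rewrite real_comb_rshift; congr (real_comb _ _).
rewrite -[RHS]hsubmxK; congr row_mx; apply/rowP => i.
by rewrite !mxE c0.
Qed.

(** The last s vectors of b1 are a real basis of ker A, whose real dimension is
    twice its complex one. *)
Lemma stacked_ker_dim : s = (2 * \dim (lker A))%N.
Proof.
apply/(real_comb_inj_dim stacked_ker_range) => c c'.
by rewrite !real_comb_rshift => /b1_inj/eq_row_mx[].
Qed.

Lemma stacked_ker_Zbasis :
  is_Zbasis ([set` lker A] `&` L1) (fun i => b1 (rshift r i)).
Proof.
have rowE (z : 'cV[int]_s) : \sum_i b1 (rshift r i) *~ z i 0 =
    \sum_i b1 i *~ col_mx 0 z i 0.
  rewrite [RHS]big_split_ord /= [X in _ = X + _]big1 ?add0r => [|i _].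
    by apply: eq_bigr => i _; rewrite col_mxEd.
  by rewrite col_mxEu mxE mulr0z.
have [b1_fun b1_Zinj b1_surj] := b1_basis; split=> [z _|z z' _ _|v [Kv Lv]] /=.
- split; last by rewrite rowE; exact: b1_fun.
  rewrite /= rpred_sum // => i _; rewrite rpredMz //.
  by rewrite memv_ker Ab_r.
- rewrite !rowE => /b1_Zinj; rewrite !inE => /(_ I I).
  by case/eq_col_mx.
have [z _ zv] := b1_surj _ Lv; exists (dsubmx z) => //.
rewrite rowE -zv; apply: eq_bigr => i _; congr (_ *~ _).
rewrite -[in RHS](vsubmxK z); congr (col_mx _ _ _ _).
apply/colP => k; rewrite !mxE.
move: Kv; rewrite -zv -(real_comb_int b1 (fun i => z i 0)) /=.
move=> /stacked_ker/(_ k).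
by rewrite mxE => /eqP; rewrite intr_eq0 => /eqP.
Qed.

End Stacked.

(** * Counting the components of the kernel *)

Section Counting.
Context {R : realType} {T1 T2 : complex_torus R} (f : torus_hom T1 T2).
Variables (r s' s : nat) (d : 'I_r -> int).
Variables (b1 : 'I_(r + s) -> universal_cover T1)
          (b2 : 'I_(r + s') -> universal_cover T2).
Hypotheses (b1_basis : is_Zbasis [set` lattice T1] b1)
           (b2_basis : is_Zbasis [set` lattice T2] b2).
Hypotheses (b1_inj : injective (real_comb b1))
           (b2_inj : injective (real_comb b2)).
Hypotheses (d_neq0 : forall i, d i != 0).
Local Notation A := (analytic_rep f).
Hypothesis Ab_l : forall i, A (b1 (lshift s i)) = b2 (lshift s' i) *~ d i.
Hypothesis Ab_r : forall i, A (b1 (rshift r i)) = 0.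

Let memA := stacked_mem b2_basis b2_inj Ab_l Ab_r.
Let kerA := stacked_ker b2_inj d_neq0 Ab_l Ab_r.
Let dR_neq0 i : (d i)%:~R != 0 :> R. Proof. by rewrite intr_eq0. Qed.

Lemma torus_ker_component_coord (c c' : 'rV[R]_(r + s)) :
  A (real_comb b1 c) \in lattice T2 -> A (real_comb b1 c') \in lattice T2 ->
  connected_component (torus_ker f) (torus_pi (real_comb b1 c)) =
  connected_component (torus_ker f) (torus_pi (real_comb b1 c')) <->
  forall i, exists z : int, c 0 (lshift s i) - c' 0 (lshift s i) = z%:~R.
Proof.
move=> Lc Lc'; rewrite torus_ker_component_eq //; split=> [[l Ll] | ex_z].
  have : range (real_comb b1) l.
    by rewrite (lattice_real_comb_range b1_basis) /= memvf.
  move=> [x _ xl]; move: Ll; rewrite -xl.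
  move=> /(mem_Zbasis_real_comb _ b1_basis b1_inj)[z xz].
  rewrite -!real_combB => /kerA c0 i; exists (z (lshift s i)).
  by move: (c0 i); rewrite xz !mxE => /subr0_eq.
have [z cz] := choice ex_z.
pose x : 'rV[R]_(r + s) := \row_k (col_mx (\col_i z i) 0 k 0)%:~R.
exists (real_comb b1 x).
  apply/(mem_Zbasis_real_comb _ b1_basis b1_inj).
  by exists (fun k => col_mx (\col_i z i) 0 k 0).
rewrite -!real_combB; apply/kerA => i.
by rewrite mxE mxE [(- c') _ _]mxE cz [(- x) _ _]mxE mxE col_mxEu mxE subrr.
Qed.

(** The elements of the product of the groups Z / d_i, represented by their least
    nonnegative residues; [coords] sends such a family k to a point of A^-1(L2)
    with coordinates k_i / d_i. *)
Local Notation residues := {dffun forall i : 'I_r, 'I_(`|d i|%N)}.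

Let coords (k : residues) : 'rV[R]_(r + s) :=
  row_mx (\row_i ((k i : nat)%:~R / (d i)%:~R)) 0.

Let coords_mem k : A (real_comb b1 (coords k)) \in lattice T2.
Proof.
apply/memA => i; exists (k i).
by rewrite row_mxEl mxE mulfVK.
Qed.

Lemma card_residues : #|{: residues}| = (\prod_i `|d i|)%N.
Proof.
rewrite card_dep_ffun foldrE big_map big_enum /=.
by apply: eq_bigr => i _; rewrite card_ord.
Qed.

(** A point of A^-1(L2) has coordinates z_i / d_i for i < r with z_i an integer, and
    z_i matters only modulo d_i: the Euclidean division of z_i by d_i shows that
    each component comes from exactly one family of residues. *)
Lemma card_torus_ker_components :
  (torus_ker_components f #= `I_(\prod_i `|d i|)%N)%card.
Proof.
pose comp k :=
  connected_component (torus_ker f) (torus_pi (real_comb b1 (coords k))).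
have -> : torus_ker_components f = comp @` [set: residues].
  apply/seteqP; split=> C [x].
    have [v ->] := torus_pi_surj x; move=> /torus_ker_pi Av <-.
    have : range (real_comb b1) v.
      by rewrite (lattice_real_comb_range b1_basis) /= memvf.
    move=> [c _ cv]; subst v.
    have /choice[z cz] := (memA c).1 Av.
    have mod_lt i : (`|(z i %% d i)%Z| < `|d i|)%N.
      rewrite -ltz_nat gez0_abs ?modz_ge0 //; exact: ltz_mod.
    exists [ffun i => Ordinal (mod_lt i)] => //.
    apply/torus_ker_component_coord => // i; exists (- (z i %/ d i)%Z).
    rewrite row_mxEl mxE ffunE /= gez0_abs ?modz_ge0 //.
    apply: (mulIf (dR_neq0 i)); rewrite mulrBl mulfVK // cz.
    have := congr1 (fun t : int => t%:~R : R) (divz_eq (z i) (d i)).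
    move: (z i %/ d i)%Z (z i %% d i)%Z => q k.
    by rewrite intrD intrM mulrNz => ->; ring.
  move=> _ <-; exists (torus_pi (real_comb b1 (coords x))) => //.
  exact/torus_ker_pi.
have comp_inj : {in [set: residues] &, injective comp}.
  move=> k k' _ _ /torus_ker_component_coord => /(_ (coords_mem _) (coords_mem _)).
  move=> kk'; apply/ffunP => i; have [z] := kk' i.
  rewrite !row_mxEl !mxE -mulrBl => /(congr1 ( *%R^~ (d i)%:~R)).
  rewrite mulfVK // -intrB -intrM => /eqP; rewrite eqr_int => /eqP kz.
  apply: val_inj => /=.
  have z0 : z = 0.
    have : (`|z| * `|d i| < `|d i|)%N.
      rewrite -abszM -kz; have := ltn_ord (k i); have := ltn_ord (k' i); lia.
    have : (0 < `|d i|)%N by rewrite absz_gt0.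
    case: (posnP `|z|%N) => [/eqP|z_gt0 d_gt0].
      by rewrite absz_eq0 => /eqP.
    by rewrite ltnNge leq_pmull.
  move: kz; rewrite z0 mul0r; lia.
apply: (card_eq_trans (inj_card_eq comp_inj)).
rewrite -card_residues.
rewrite card_eq_sym; apply: (card_eq_trans card_II).
rewrite card_eq_sym.
have <- : @enum_rank residues @` setT = setT.
  by apply/seteqP; split=> // x _; exists (enum_val x) => //; rewrite enum_valK.
rewrite card_eq_sym; apply: inj_card_eq => x y _ _; exact: enum_rank_inj.
Qed.
End Counting.

Section Degree.
Context {R : realType} {T1 T2 : complex_torus R} (f : torus_hom T1 T2).
Local Notation A := (analytic_rep f).

Lemma preim_lattice_countable : finite_set (torus_ker f) ->
  countable [set v | A v \in lattice T2].
Proof.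
move=> ker_fin.
apply: (@sub_countable _ _ _
  (\bigcup_(x in torus_ker f) [set repr x + l | l in [set` lattice T1]])).
  apply: subset_card_le => v /= Av; exists (torus_pi v); first exact/torus_ker_pi.
  exists (v - repr (torus_pi v)); last by rewrite addrC subrK.
  by apply/torus_pi_eq; rewrite {2}/torus_pi reprK.
apply: bigcup_countable; first exact: finite_set_countable.
move=> x _; apply: sub_countable (lattice_countable T1); exact: card_image_le.
Qed.

(** ker A lies in A^-1(L2), which is a finite union of translates of L1 and
    hence countable. *)
Lemma lker_eq0_finite_torus_ker : finite_set (torus_ker f) -> lker A = 0%VS.
Proof.
move=> /preim_lattice_countable K_count; apply/eqP; rewrite -subv0.
apply: (vspace_sub_mod_countable K_count) => v.
rewrite memv_ker => /eqP Av; exists v; last by rewrite subrr mem0v.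
by rewrite /= Av rpred0.
Qed.

(** When A is injective the components of ker f are points. *)
Lemma card_torus_ker_components_lker0 : lker A = 0%VS ->
  (torus_ker_components f #= torus_ker f)%card.
Proof.
move=> kerA0; rewrite /torus_ker_components.
have compE x : torus_ker f x -> connected_component (torus_ker f) x = [set x].
  have [v ->] := torus_pi_surj x; move=> /torus_ker_pi Av.
  rewrite torus_ker_componentE //; apply/seteqP; split=> [_ [u /= Au <-]|_ ->].
    suff -> : u = v by [].
    apply/eqP; rewrite -subr_eq0 -memv0 -kerA0 memv_ker.
    by rewrite linearB /= Au subrr.
  by exists v.
apply: inj_card_eq => x y /set_mem xK /set_mem yK.
by rewrite !compE // => /seteqP[/(_ x erefl)].
Qed.
End Degree.

(** * Degree and number of components as determinantal divisors *)

Theorem corollary7 (R : realType) (T1 T2 : complex_torus R)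
    (f : torus_hom T1 T2)
    (e1 : 'I_(2 * torus_dim T1) -> universal_cover T1)
    (e2 : 'I_(2 * torus_dim T2) -> universal_cover T2)
    (he1 : is_Zbasis [set` lattice T1] e1)
    (he2 : is_Zbasis [set` lattice T2] e2) :
  let g1 := torus_dim T1 in
  let h := subtorus_dim (torus_ker0 f) in
  let delta := det_divisor (rational_rep_mx f e1 e2) in
  torus_deg f = delta (2 * g1)%N /\
  (torus_ker_components f #= `I_(delta (2 * (g1 - h))%N))%card.
Proof.
move=> g1 h delta.
have Ae j : analytic_rep f (e1 j) = \sum_i e2 i *~ rational_rep_mx f e1 e2 i j.
  under eq_bigr do rewrite mxE; apply: (Zcoord_Zbasis he2).
  exact/analytic_rep_lattice/(Zbasis_mem j he1).
have [r [s' [s [d [b1 [b2 stacked]]]]]] := stacked_bases he1 he2 Ae.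
move: stacked => [[dim_n dim_m b1_basis b2_basis]].
move=> [d_neq0 Ab_l Ab_r] delta_r delta_gt.
rewrite -/delta in delta_r delta_gt.
have b1_inj := lattice_real_comb_inj b1_basis dim_n.
have b2_inj := lattice_real_comb_inj b2_basis dim_m.
have b1_range := lattice_real_comb_range b1_basis.
have s_dim := stacked_ker_dim b1_range b1_inj b2_inj d_neq0 Ab_l Ab_r.
set A := analytic_rep f in Ae Ab_l Ab_r s_dim.
have h_dim : h = \dim (lker A).
  rewrite /h torus_ker0E subtorus_dimE //; split.
  - by apply: (subset_isolated _ (@lattice_isolated _ T1)) => v [].
  - rewrite -s_dim; exists (fun i => b1 (rshift r i)).
    exact: stacked_ker_Zbasis b1_basis b2_inj d_neq0 Ab_l Ab_r.
  - rewrite (real_span_Zbasis (stacked_ker_Zbasis b1_basis b2_inj d_neq0 Ab_l Ab_r)).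
    exact: stacked_ker_range b1_range b2_inj d_neq0 Ab_l Ab_r.
have r_dim : (2 * (g1 - h))%N = r by rewrite h_dim; lia.
have card_comp : (torus_ker_components f #= `I_(delta r))%card.
  rewrite delta_r; exact: (card_torus_ker_components b1_basis b2_basis
                             b1_inj b2_inj d_neq0 Ab_l Ab_r).
split; last by rewrite r_dim.
have ker_card : \dim (lker A) = 0%N -> (torus_ker f #= `I_(delta (2 * g1)))%card.
  move=> /eqP; rewrite dimv_eq0 => /eqP kerA0.
  have -> : (2 * g1)%N = r by rewrite -r_dim h_dim kerA0 dimv0 subn0.
  apply: (card_eq_trans _ card_comp).
  by rewrite card_eq_sym card_torus_ker_components_lker0.
rewrite /torus_deg; case: asboolP => [ker_fin|ker_inf].
  apply: card_fset_set; apply: ker_card.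
  by rewrite /A lker_eq0_finite_torus_ker // dimv0.
apply/esym/delta_gt; rewrite ltnNge; apply/negP => le_r; apply: ker_inf.
apply/finite_setP; exists (delta (2 * g1)%N); apply: ker_card.
by rewrite /g1 in le_r; lia.
Qed.
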